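(* The operator $\operatorname{cl}^{*}_{\mathfrak{a}}$ is not idempotent in general: there exist an ideal-aura topological space $(X,\tau,\mathcal{I},\mathfrak{a})$ and a set $A\subseteq X$ such that $\operatorname{cl}^{*}_{\mathfrak{a}}(\operatorname{cl}^{*}_{\mathfrak{a}}(A))\neq\operatorname{cl}^{*}_{\mathfrak{a}}(A)$.
   Context: An ideal on a set $X$ is a non-empty collection $\mathcal{I}\subseteq\mathcal{P}(X)$ closed under taking subsets and finite unions. A scope function on a topological space $(X,\tau)$ is a function $\mathfrak{a}:X\to\tau$ with $x\in\mathfrak{a}(x)$ for every $x\in X$. An ideal-aura topological space $(X,\tau,\mathcal{I},\mathfrak{a})$ is a topological space $(X,\tau)$ with an ideal $\mathcal{I}$ on $X$ and a scope function $\mathfrak{a}:X\to\tau$. For $A\subseteq X$, the aura-local function is $A^{\mathfrak{a}}(\mathcal{I})=\{x\in X:\mathfrak{a}(x)\cap A\notin\mathcal{I}\}$ and the ideal-aura closure is $\operatorname{cl}^{*}_{\mathfrak{a}}(A)=A\cup A^{\mathfrak{a}}(\mathcal{I})$. *)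

(* Defs.v *)
From mathcomp Require Import all_boot all_classical topology.

Set Implicit Arguments.
Unset Strict Implicit.
Unset Printing Implicit Defensive.

Local Open Scope classical_set_scope.

(* An ideal need not be proper: [setT] may belong to [I]. Closure under binary
   unions gives all finite unions, since the other two clauses yield [I set0]. *)
Definition is_ideal (X : Type) (I : set (set X)) : Prop :=
  [/\ I !=set0,
      forall A B : set X, B `<=` A -> I A -> I B
    & setU_closed I].

Definition is_scope_function (X : topologicalType) (a : X -> set X) : Prop :=
  forall x : X, open (a x) /\ a x x.

Definition aura_local (X : Type) (I : set (set X)) (a : X -> set X)
    (A : set X) : set X :=
  [set x | ~ I (a x `&` A)].

Definition ideal_aura_closure (X : Type) (I : set (set X)) (a : X -> set X)
    (A : set X) : set X :=
  A `|` aura_local I a A.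

(* Main.v *)
Require Import Defs.
From mathcomp Require Import all_boot all_classical topology.

(** On the discrete space of natural numbers, with the trivial ideal and
    scopes [{x, x + 1}], a point [x] joins the closure of a set exactly when
    the set contains [x + 1]: each application reaches one step further down. *)

Local Open Scope classical_set_scope.

Theorem theorem4p3 :
  exists (X : topologicalType) (I : set (set X)) (a : X -> set X) (A : set X),
    [/\ is_ideal I,
        is_scope_function a
      & ideal_aura_closure I a (ideal_aura_closure I a A)
          <> ideal_aura_closure I a A].
Proof.
(* The closure of [[set 2]] is {1, 2}, whose closure is {0, 1, 2}; 2 is the least point with room
   for two steps down. *)
exists nat, [set set0], (fun x => [set x; x.+1]), [set 2]; split.
- split; first by exists set0.
  + by move=> A B BA /= A0; rewrite A0 subset0 in BA.
  + by move=> A B /= -> ->; rewrite setU0.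
- by move=> x; split; [exact: discrete_open | left].
- move=> clcl.
  have : ideal_aura_closure [set set0] (fun x => [set x; x.+1]) [set 2] 0.
    (* The scope of 0 meets the closure at 1, which belongs there because its own scope meets
       [[set 2]] at 2. *)
    rewrite -clcl; right=> /= cap0.
    suff : (set0 : set nat) 1 by [].
    rewrite -cap0; split; first by right.
    right=> /= cap0'; suff : (set0 : set nat) 2 by [].
    by rewrite -cap0'; split; first by right.
  (* But 0 is not 2, and its scope {0, 1} misses 2, so one closure does not reach 0. *)
  case=> //; apply; rewrite /= -subset0 => y [] /= yE y2.
  by case: yE => ?; subst y.
Qed.
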